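(* Let $G$ be a finite directed graph such that the undirected graph $\nabla G$ contains a cycle. Then the stable composite state problem (''given a CFSM protocol $\mathbf P$ with communication graph $G$ and a composite state $S$ of $\mathbf P$, is $S$ stable?'') is algorithmically undecidable for CFSM protocols with communication graph $G$.
   Context: For a directed graph $G$, $\nabla G$ denotes the corresponding undirected (multi)graph obtained by forgetting edge orientations (parallel edges are kept, so e.g. two opposite edges between the same two nodes form a cycle). A CFSM protocol $\mathbf P$ with communication graph $G=(N,E)$ (each edge $\xi$ has tail $-\xi$ and head $+\xi$) consists of pairwise disjoint finite message sets $M_\xi$, $\xi\in E$, and for each $j\in N$ a finite state machine $F_j=(K_j,\Sigma_j,T_j,h_j)$ with finite state set $K_j$, initial state $h_j$, alphabet $\Sigma_j=\{+b: b\in M_\xi,\ j=+\xi\}\cup\{-b: b\in M_\xi,\ j=-\xi\}$ and transitions $T_j\subseteq K_j\times\Sigma_j\times K_j$ ($+b$ = receive, $-b$ = send). A composite state is $S=(p_j:j\in N)$, $p_j\in K_j$; a channel content is $C=(x_\xi:\xi\in E)$, $x_\xi\in M_\xi^*$; global states are pairs $(S,C)$; $C^0$ has all components empty and the initial global state is $((h_j:j\in N),C^0)$. A step: some machine $F_i$ takes a transition $p_i\xrightarrow{-b}q_i$ with $b\in M_\beta$, $i=-\beta$, and $b$ is appended to the end of $x_\beta$; or takes $p_i\xrightarrow{+b}q_i$ with $b\in M_\beta$, $i=+\beta$, where $x_\beta$ begins with $b$ and this first symbol is removed; all other machine states and channels are unchanged. A composite state $S$ is stable if the global state $(S,C^0)$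 is reachable from the initial global state by finitely many steps. *)

(* Defs.v *)
From Stdlib Require Import Relations.
From mathcomp Require Import all_boot.
Set Implicit Arguments. Unset Strict Implicit. Unset Printing Implicit Defensive.

Inductive recf : Type :=
| RZero : recf
| RSucc : recf
| RProj : nat -> recf                   (* i-th argument (0 if absent) *)
| RComp : recf -> list recf -> recf
| RPrec : recf -> recf -> recf
| RMu   : recf -> recf.

Inductive reval : recf -> seq nat -> nat -> Prop :=
| ev_zero xs : reval RZero xs 0
| ev_succ xs : reval RSucc xs (nth 0 xs 0).+1
| ev_proj i xs : reval (RProj i) xs (nth 0 xs i)
| ev_comp f gs xs ys y :
    revals gs xs ys -> reval f ys y -> reval (RComp f gs) xs y
| ev_prec0 f g xs y : reval f xs y -> reval (RPrec f g) (0 :: xs) y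
| ev_precS f g n xs r y :
    reval (RPrec f g) (n :: xs) r -> reval g (n :: r :: xs) y ->
    reval (RPrec f g) (n.+1 :: xs) y
| ev_mu f xs n :
    reval f (n :: xs) 0 ->
    (forall m, m < n -> exists k, reval f (m :: xs) k.+1) ->
    reval (RMu f) xs n
with revals : list recf -> seq nat -> seq nat -> Prop :=
| evs_nil xs : revals nil xs [::]
| evs_cons g gs xs y ys :
    reval g xs y -> revals gs xs ys -> revals (g :: gs) xs (y :: ys).

Definition decidable_on (X : countType) (valid P : X -> Prop) : Prop :=
  exists f : recf, forall x : X, valid x ->
    (P x -> reval f [:: pickle x] 1) /\ (~ P x -> reval f [:: pickle x] 0).

(* Graphs: a finite directed (multi)graph is given by finite types of  *)
(* nodes N and edges E, with tail and head maps.                       *)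

(* The undirected multigraph nabla G contains a cycle: pairwise distinct
   edges e_0..e_k and pairwise distinct nodes v_0..v_k such that e_i joins
   v_i and v_(i+1 mod k+1) (in either orientation). A loop is a cycle of
   length 1, two parallel (or opposite) edges form a cycle of length 2. *)
Definition undirected_has_cycle (N E : finType) (tl hd : E -> N) : Prop :=
  exists (k : nat) (es : 'I_k.+1 -> E) (vs : 'I_k.+1 -> N),
    injective es /\ injective vs /\
    forall i : 'I_k.+1,
      (tl (es i) = vs i /\ hd (es i) = vs (ordS i)) \/
      (hd (es i) = vs i /\ tl (es i) = vs (ordS i)).

(* Messages are natural numbers; the states of machine F_j are         *)
(* 0, ..., nstates j - 1.  A transition (p, snd, b, q) of F_j is        *)
(*   p --(-b)--> q if snd = true  (send b),                            *)
(*   p --(+b)--> q if snd = false (receive b).                         *)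
Section CFSM.
Variables (N E : finType) (tl hd : E -> N).

Definition protocol : Type :=
  ({ffun E -> seq nat}
   * {ffun N -> nat}
   * {ffun N -> nat}
   * {ffun N -> seq (nat * bool * nat * nat)})%type.

Definition msgs (P : protocol) : E -> seq nat := P.1.1.1.
Definition nstates (P : protocol) : N -> nat := P.1.1.2.
Definition init (P : protocol) : N -> nat := P.1.2.
Definition trans (P : protocol) : N -> seq (nat * bool * nat * nat) := P.2.

Definition composite_state : Type := {ffun N -> nat}.
Definition channels : Type := {ffun E -> seq nat}.

Definition wf_protocol (P : protocol) : Prop :=
  (forall xi zeta : E, xi != zeta ->
     forall b, b \in msgs P xi -> b \notin msgs P zeta) /\
  (forall j, init P j < nstates P j) /\
  (forall j p snd b q, (p, snd, b, q) \in trans P j ->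
     [/\ p < nstates P j, q < nstates P j &
         (exists xi : E, b \in msgs P xi /\
                        (if snd then tl xi = j else hd xi = j))]).

Definition is_composite_state (P : protocol) (St : composite_state) : Prop :=
  forall j, St j < nstates P j.

Definition step (P : protocol) (g g' : composite_state * channels) : Prop :=
  let: (St, C) := g in let: (St2, C') := g' in
  exists (j : N) (p : nat) (snd : bool) (b : nat) (q : nat) (xi : E),
    [/\ (p, snd, b, q) \in trans P j,
        St j = p /\ St2 j = q,
        (forall k, k != j -> St2 k = St k),
        b \in msgs P xi &
        (forall zeta, zeta != xi -> C' zeta = C zeta) /\
        (if snd then tl xi = j /\ C' xi = rcons (C xi) b
         else hd xi = j /\ C xi = b :: C' xi)].

Definition empty_channels : channels := [ffun _ => [::]].

Definition initial_global (P : protocol) : composite_state * channels :=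
  ([ffun j => init P j], empty_channels).

Definition stable (P : protocol) (St : composite_state) : Prop :=
  clos_refl_trans _ (step P) (initial_global P) (St, empty_channels).

End CFSM.

Definition scs_input (N E : finType) : countType :=
  (protocol N E * composite_state N)%type.

Definition scs_valid (N E : finType) (tl hd : E -> N)
  (x : scs_input N E) : Prop :=
  wf_protocol tl hd x.1 /\ is_composite_state x.1 x.2.

Definition scs_stable (N E : finType) (tl hd : E -> N)
  (x : scs_input N E) : Prop :=
  stable tl hd x.1 x.2.

(* Main.v *)
From Stdlib Require Import Relations.
Require Import Defs.
From mathcomp Require Import all_boot zify.
Set Implicit Arguments. Unset Strict Implicit. Unset Printing Implicit Defensive.

(** Suppose a recursive function [f] decides the problem. One node of the cycle,
    the controller, simulates a program on a queue of unary counters, and the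
    other nodes of the cycle relay letters. Whatever the orientations, an edge
    of the cycle carries the same word as its neighbours, up to what is still in
    transit; hence reaching empty channels means that the word the controller
    produces on one side is the word it consumes on the other, as for a queue.
    As the controller is deterministic, such a run can only be the genuine queue
    computation, even if the edges allow letters to be consumed early.

    The controller program first loads a number [x] in unary, and the code of the
    whole protocol is a primitive recursive function [D] of [x] when [x] is the
    code of the remaining transition list. Compiling the recursive function
    "run [f] on [D x], accept iff the result is 0" to such a program and loading
    the code of its own transition list yields a protocol that is stable iff [f]
    says that it is not. *)

(** * Computable functions on codes *)

Definition computable (k : nat) (F : seq nat -> nat) : Prop :=
  exists f, forall xs, size xs = k -> reval f xs (F xs).

Lemma revals_proj n m xs :
  revals [seq RProj i | i <- iota n m] xs [seq nth 0 xs i | i <- iota n m].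
Proof. by elim: m n => [|m IH] n /=; constructor; [constructor | apply: IH]. Qed.

Lemma computable_ext k F G :
  (forall xs, size xs = k -> F xs = G xs) -> computable k F -> computable k G.
Proof. by move=> eFG [f fP]; exists f => xs sx; rewrite -eFG //; apply: fP. Qed.

Lemma computable_nth k i : computable k (nth 0 ^~ i).
Proof. by exists (RProj i) => xs _; constructor. Qed.

Lemma computable_succ k F : computable k F -> computable k (fun xs => (F xs).+1).
Proof.
case=> f fP; exists (RComp RSucc [:: f]) => xs sx.
apply: (@ev_comp _ _ _ [:: F xs]); last exact: ev_succ.
by constructor; [apply: fP | constructor].
Qed.

Lemma computable_const k c : computable k (fun=> c).
Proof.
elim: c => [|c]; last exact: computable_succ.
by exists RZero => xs _; constructor.
Qed.

(** Weakening: the step function of a recursion receives the counter and the accumulator in front of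
    the parameters. *)
Lemma computable_drop k m F :
  computable k F -> computable (m + k) (fun xs => F (drop m xs)).
Proof.
case=> f fP; exists (RComp f [seq RProj i | i <- iota m k]) => xs sx.
apply: (ev_comp (revals_proj _ _ _)).
have -> : [seq nth 0 xs i | i <- iota m k] = drop m xs.
  apply: (@eq_from_nth _ 0) => [|i]; rewrite size_map size_iota ?size_drop ?sx ?addKn //.
  by move=> ltik; rewrite (nth_map 0) ?size_iota // nth_iota // nth_drop.
by apply: fP; rewrite size_drop sx addKn.
Qed.

(** [RPrec] recurses on its first argument; composing it with [h] and all projections lets any
    computable [H] bound the recursion. *)
Lemma computable_prec k F G H :
  computable k F -> computable k.+2 G -> computable k H ->
  computable k (fun xs => nat_rect (fun=> nat) (F xs)
                            (fun n r => G (n :: r :: xs)) (H xs)).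
Proof.
case=> [f fP] [g gP] [h hP].
exists (RComp (RPrec f g) (h :: [seq RProj i | i <- iota 0 k])) => xs sx.
apply: (ev_comp (ys := H xs :: xs)).
  constructor; first exact: hP.
  by rewrite -{2}(mkseq_nth 0 xs) sx; apply: revals_proj.
elim: (H xs) => [|n IH] /=; first by constructor; apply: fP.
by apply: ev_precS IH _; apply: gP; rewrite /= sx.
Qed.

Lemma computable_add k F G :
  computable k F -> computable k G -> computable k (fun xs => F xs + G xs).
Proof.
move=> cF cG; have := computable_prec cF (computable_succ (computable_nth _ 1)) cG.
by apply: computable_ext => xs _; elim: (G xs) => [|n /= ->]; rewrite ?addn0 ?addnS.
Qed.

Lemma computable_mul k F G :
  computable k F -> computable k G -> computable k (fun xs => F xs * G xs).
Proof.
move=> cF cG.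
have := computable_prec (computable_const k 0)
  (computable_add (computable_drop 2 cF) (computable_nth _ 1)) cG.
apply: computable_ext => xs _; elim: (G xs) => [|n /= ->]; first by rewrite muln0.
by rewrite drop0 mulnS.
Qed.

Lemma computable_pow2 k F : computable k F -> computable k (fun xs => 2 ^ F xs).
Proof.
move=> cF; have := computable_prec (computable_const k 1)
  (computable_add (computable_nth _ 1) (computable_nth _ 1)) cF.
apply: computable_ext => xs _; elim: (F xs) => [|n /= ->] //.
by rewrite expnS mul2n addnn.
Qed.

(** The formula is the one by which [CodeSeq.code] puts a head in front of an already coded list. *)
Lemma computable_code_cons k F G :
  computable k F -> computable k G ->
  computable k (fun xs => 2 ^ F xs * (G xs).*2.+1).
Proof.
move=> cF cG; apply: computable_mul; first exact: computable_pow2.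
apply: computable_succ; apply: computable_ext (computable_add cG cG).
by move=> xs _; rewrite addnn.
Qed.

Lemma computable_code (T : Type) (s : seq T) k (F : T -> seq nat -> nat) :
  (forall t, computable k (F t)) ->
  computable k (fun xs => CodeSeq.code [seq F t xs | t <- s]).
Proof.
move=> cF; elim: s => [|t s IH] /=; first exact: computable_const.
exact: computable_code_cons.
Qed.

Lemma computable_code2 k F G : computable k F -> computable k G ->
  computable k (fun xs => CodeSeq.code [:: F xs; G xs]).
Proof.
move=> cF cG; apply: computable_code_cons => //.
by apply: computable_code_cons => //; apply: computable_const.
Qed.

Lemma pickle_pair (A B : countType) (a : A) (b : B) :
  pickle (a, b) = CodeSeq.code [:: pickle a; pickle b].
Proof. by []. Qed.

Lemma pickle_seqE (A : countType) (s : seq A) :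
  pickle s = CodeSeq.code [seq pickle a | a <- s].
Proof. by []. Qed.

(** [pickle] on finite functions is inherited from [tfgraph]; the explicit list lets the code of a
    protocol be computed entry by entry. *)
Lemma pickle_ffunE (T : finType) (A : countType) (f : {ffun T -> A}) :
  pickle f = CodeSeq.code [seq CodeSeq.code [:: pickle t; pickle (f t)] | t <- enum T].
Proof.
transitivity (pickle (tfgraph f)); first by rewrite {1}/pickle; unlock.
transitivity (pickle (val (tfgraph f))) => //.
by rewrite pickle_seqE /= /codom /image_mem -map_comp; congr CodeSeq.code; apply: eq_map.
Qed.

(** * Loop programs *)

(* [Loop i P] is "while register i is positive, decrement it and run P". *)
Inductive prog :=
| Skip
| Inc of nat
| Seq of prog & prog
| Loop of nat & prog.

Definition upd (s : nat -> nat) (i v : nat) : nat -> nat :=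
  fun j => if j == i then v else s j.

Inductive exec : prog -> (nat -> nat) -> (nat -> nat) -> Prop :=
| exec_skip s : exec Skip s s
| exec_inc i s : exec (Inc i) s (upd s i (s i).+1)
| exec_seq P Q s s1 s2 : exec P s s1 -> exec Q s1 s2 -> exec (Seq P Q) s s2
| exec_loop0 i P s : s i = 0 -> exec (Loop i P) s s
| exec_loopS i P s n s1 s2 :
    s i = n.+1 -> exec P (upd s i n) s1 -> exec (Loop i P) s1 s2 ->
    exec (Loop i P) s s2.

Definition clear a := Loop a Skip.
Definition move a b := Seq (clear b) (Loop a (Inc b)).
(** A loop destroys the register it tests, so [t] receives a second copy from which [a] is
    restored. *)
Definition copy a b t :=
  Seq (Seq (clear b) (clear t))
      (Seq (Loop a (Seq (Inc b) (Inc t))) (Loop t (Inc a))).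

Ltac upd_cases := rewrite /upd; repeat (case: eqP => ?); subst => //=; try lia.

Lemma exec_clear a s : exists2 s', exec (clear a) s s' & s' =1 upd s a 0.
Proof.
have [n sa] : exists n, s a = n by exists (s a).
elim: n s sa => [|n IH] s sa.
  by exists s; [apply: exec_loop0 | move=> j; upd_cases].
have [|s' xs' s'E] := IH (upd s a n); first by upd_cases.
exists s'; first by apply: exec_loopS sa _ xs'; apply: exec_skip.
by move=> j; rewrite s'E; upd_cases.
Qed.

Lemma exec_addto a b s : a != b ->
  exists2 s', exec (Loop a (Inc b)) s s' & s' =1 upd (upd s b (s b + s a)) a 0.
Proof.
move=> nab; have [n sa] : exists n, s a = n by exists (s a).
elim: n s sa => [|n IH] s sa.
  by exists s; [apply: exec_loop0 | move=> j; upd_cases].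
set s1 := upd s a n.
have [|s' xs' s'E] := IH (upd s1 b (s1 b).+1); first by rewrite /s1; upd_cases.
exists s'; first by apply: exec_loopS sa _ xs'; apply: exec_inc.
by move=> j; rewrite s'E /s1; upd_cases.
Qed.

Lemma exec_move a b s : a != b ->
  exists2 s', exec (move a b) s s' & s' =1 upd (upd s b (s a)) a 0.
Proof.
move=> nab; have [s1 x1 e1] := exec_clear b s.
have [s2 x2 e2] := exec_addto s1 nab.
exists s2; first exact: exec_seq x1 x2.
by move=> j; rewrite e2 /upd !e1; upd_cases.
Qed.

Lemma exec_copy a b t s : a != b -> a != t -> b != t ->
  exists2 s', exec (copy a b t) s s' & s' =1 upd (upd s b (s a)) t 0.
Proof.
move=> nab nat nbt.
have [s1 x1 e1] := exec_clear b s; have [s2 x2 e2] := exec_clear t s1.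
have [s3 x3 e3] : exists2 s3, exec (Loop a (Seq (Inc b) (Inc t))) s2 s3 &
    s3 =1 upd (upd (upd s2 b (s2 b + s2 a)) t (s2 t + s2 a)) a 0.
  move: s2 {x2 e2} => s2; have [n sa] : exists n, s2 a = n by exists (s2 a).
  elim: n s2 sa => [|n IH] s2 sa.
    by exists s2; [apply: exec_loop0 | move=> j; upd_cases].
  set s3 := upd s2 a n; set s4 := upd s3 b (s3 b).+1.
  have [|s' xs' s'E] := IH (upd s4 t (s4 t).+1); first by rewrite /s4 /s3; upd_cases.
  exists s'.
    by apply: exec_loopS sa _ xs'; apply: exec_seq; apply: exec_inc.
  by move=> j; rewrite s'E /s4 /s3; upd_cases.
have nta : t != a by rewrite eq_sym.
have [s4 x4 e4] := exec_addto s3 nta.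
exists s4; first exact: exec_seq (exec_seq x1 x2) (exec_seq x3 x4).
by move=> j; rewrite e4 /upd !e3 /upd !e2 /upd !e1; upd_cases.
Qed.

(** Arguments sit in the registers [ins]; those from [n] on are scratch. For [RPrec], [n] counts
    down, [n.+1] counts up, [n.+2] holds the current value and [n.+3] the next one. For [RMu], [n]
    is the candidate and [n.+1] the value of [f] there, recomputed at every pass, so that its
    decrement by the loop is harmless. *)
Fixpoint compile (f : recf) (ins : seq nat) (out n : nat) : prog :=
  let fetch i := if i < size ins then copy (nth 0 ins i) out n else clear out in
  match f with
  | RZero => clear out
  | RSucc => Seq (fetch 0) (Inc out)
  | RProj i => fetch i
  | RComp f gs =>
      let m := n + size gs in
      Seq ((fix compile_args gs a := match gs with
            | nil => Skip
            | g :: gs' => Seq (compile g ins a m) (compile_args gs' a.+1)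
            end) gs n)
          (compile f (iota n (size gs)) out m)
  | RPrec f g =>
      if ins is a :: ins' then
        Seq (Seq (compile f ins' n.+2 n.+4) (Seq (copy a n n.+3) (clear n.+1)))
            (Seq (Loop n (Seq (compile g [:: n.+1, n.+2 & ins'] n.+3 n.+4)
                              (Seq (move n.+3 n.+2) (Inc n.+1))))
                 (move n.+2 out))
      else Skip
  | RMu f =>
      Seq (Seq (clear n) (compile f (n :: ins) n.+1 n.+2))
          (Seq (Loop n.+1 (Seq (Inc n) (compile f (n :: ins) n.+1 n.+2)))
               (move n out))
  end.

(** The inner fixpoint of [compile] as a function of its own, so that induction on [gs] can speak
    about it. *)
Fixpoint compile_args (gs : seq recf) (ins : seq nat) (a m : nat) : prog :=
  if gs is g :: gs' then Seq (compile g ins a m) (compile_args gs' ins a.+1 m)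
  else Skip.

Lemma compile_comp f gs ins out n :
  compile (RComp f gs) ins out n =
  Seq (compile_args gs ins n (n + size gs))
      (compile f (iota n (size gs)) out (n + size gs)).
Proof.
rewrite /=; congr Seq; move: (n + size gs) => m.
by elim: gs n => //= g gs IH n; rewrite IH.
Qed.

(** The automatic principle gives no hypothesis on the functions in the list of [RComp]; a nested
    fixpoint recovers it. *)
Lemma recf_nested_ind (P : recf -> Prop) :
  P RZero -> P RSucc -> (forall i, P (RProj i)) ->
  (forall f gs, P f -> List.Forall P gs -> P (RComp f gs)) ->
  (forall f g, P f -> P g -> P (RPrec f g)) ->
  (forall f, P f -> P (RMu f)) -> forall f, P f.
Proof.
move=> P0 PS Pp Pc Pr Pm; fix IH 1 => -[||i|f gs|f g|f].
- exact: P0.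
- exact: PS.
- exact: Pp.
- apply: Pc; first exact: IH.
  by elim: gs => [|g gs IHgs]; constructor.
- by apply: Pr; apply: IH.
- by apply: Pm; apply: IH.
Qed.

(** Partial functions are covered, since only arguments with a value are considered. Scratch
    registers may hold anything before and after, which lets successive calls reuse them. *)
Definition computes f := forall xs y s ins out n,
  reval f xs y -> xs = [seq s i | i <- ins] -> all (ltn^~ n) ins ->
  out < n -> out \notin ins ->
  exists2 s', exec (compile f ins out n) s s' &
    s' out = y /\ forall i, i < n -> i != out -> s' i = s i.

Lemma exec_fetch s ins out n i :
  all (ltn^~ n) ins -> out < n -> out \notin ins ->
  exists2 s', exec (if i < size ins then copy (nth 0 ins i) out n else clear out) s s' &
    s' out = nth 0 [seq s i | i <- ins] i /\
    forall j, j < n -> j != out -> s' j = s j.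
Proof.
move=> insn lto nin; case: ltnP => [lti|lei]; last first.
  have [s' x e] := exec_clear out s; exists s' => //.
  rewrite e /upd eqxx nth_default ?size_map //; split=> // j _ /negPf nj.
  by rewrite e /upd nj.
have ini := mem_nth 0 lti; have /= ltin := allP insn _ ini.
have [|||s' x e] := @exec_copy (nth 0 ins i) out n s.
- by apply: contra nin => /eqP <-.
- by rewrite neq_ltn ltin.
- by rewrite neq_ltn lto.
exists s' => //; rewrite e /upd eqxx (nth_map 0) // ltn_eqF //; split=> // j ltj nj.
by rewrite e /upd ltn_eqF // (negPf nj).
Qed.

Lemma exec_compile_args gs s ins a m xs ys :
  List.Forall computes gs -> revals gs xs ys -> xs = [seq s i | i <- ins] ->
  all (ltn^~ a) ins -> a + size gs <= m ->
  exists2 s', exec (compile_args gs ins a m) s s' &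
    ys = [seq s' i | i <- iota a (size gs)] /\ forall i, i < a -> s' i = s i.
Proof.
elim: gs s a ys => [|g gs IH] s a ys cgs evs xsE lta lem.
  by exists s; [apply: exec_skip | inversion evs].
inversion cgs as [|? ? cg cgs']; inversion evs as [|? ? ? y ys' evg evgs]; subst g0 gs0 ys l x.
have [|||s1 x1 [e1 e1']] := cg _ _ s ins a m evg xsE.
- by apply: sub_all lta => i; rewrite /=; move: lem => /=; lia.
- by move: lem => /=; lia.
- by apply/negP => /(allP lta); rewrite /= ltnn.
have same : forall i, i < a -> s1 i = s i.
  by move=> i ltia; apply: e1'; move: lem => /=; lia.
have [|||||s2 x2 [e2 e2']] := IH s1 a.+1 ys'.
- by [].
- by [].
- by rewrite xsE; apply/eq_in_map => i /(allP lta) /= ltia; rewrite same.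
- by apply: sub_all lta => i /=; lia.
- by move: lem => /=; lia.
exists s2; first exact: exec_seq x1 x2.
split=> [|i ltia]; first by rewrite /= e2' // e1 e2.
by rewrite e2' ?same //; lia.
Qed.

(** The derivation unfolds from [m] downwards, whereas the compiled loop computes upwards; the
    sequence [r] of intermediate values links the two. *)
Lemma prec_trace f g m xs y : reval (RPrec f g) (m :: xs) y ->
  exists r : nat -> nat, [/\ reval f xs (r 0),
    forall i, i < m -> reval g [:: i, r i & xs] (r i.+1) & r m = y].
Proof.
elim: m y => [|m IH] y ev; inversion ev; subst; first by exists (fun=> y).
match goal with H : reval (RPrec f g) _ _ |- _ => have [t [t0 tS tm]] := IH _ H end.
exists (upd t m.+1 y); split; first by upd_cases.
  move=> i; rewrite ltnS leq_eqVlt => /predU1P[->|lti].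
    by rewrite /upd eqxx ltn_eqF // tm.
  by rewrite /upd !ltn_eqF ?ltnS //; [apply: tS | apply: ltnW].
by rewrite /upd eqxx.
Qed.

Lemma compile_computes f : computes f.
Proof.
elim/recf_nested_ind: f => [||i|f gs cf cgs|f g cf cg|f cf].
- move=> xs y s ins out n ev xsE insn lto nin; inversion ev; subst.
  have [s' x e] := exec_clear out s; exists s' => //.
  by rewrite e /upd eqxx; split=> // j _ /negPf nj; rewrite e /upd nj.
- move=> xs y s ins out n ev xsE insn lto nin; inversion ev; subst.
  have [s' x [e e']] := exec_fetch s 0 insn lto nin.
  exists (upd s' out (s' out).+1); first by apply: exec_seq x _; apply: exec_inc.
  by rewrite /upd eqxx e; split=> // j ltj nj; rewrite (negPf nj) e'.
- move=> xs y s ins out n ev xsE insn lto nin; inversion ev; subst.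
  exact: exec_fetch.
- move=> xs y s ins out n ev xsE insn lto nin; rewrite compile_comp.
  inversion ev as [| | |? ? ? ys ? evs evf| | |]; subst f0 gs0 xs0 y0.
  have [s1 x1 [e1 e1']] := exec_compile_args cgs evs xsE insn (leqnn _).
  have [|||s2 x2 [e2 e2']] := cf _ _ s1 (iota n (size gs)) out (n + size gs) evf e1.
  + by apply/allP => i; rewrite mem_iota => /andP[].
  + exact: ltn_addr.
  + by rewrite mem_iota leqNgt lto.
  exists s2; first exact: exec_seq x1 x2.
  by split=> // j ltj nj; rewrite e2' ?e1' // ltn_addr.
- move=> xs y s ins out n ev xsE insn lto nin.
  case: ins xsE insn nin => [|a ins] xsE; first by rewrite xsE in ev; inversion ev.
  rewrite inE negb_or /= => /andP[lta insn] /andP[noa nin].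
  have {}insn i : i \in ins -> i < n by move/(allP insn).
  rewrite {}xsE /= in ev; have [r [rf rg ry]] := prec_trace ev.
  have [|||s1 x1 [e1 e1']] := cf _ _ s ins n.+2 n.+4 rf (erefl _).
  + by apply/allP => i /insn /=; lia.
  + by lia.
  + by apply/negP => /insn; lia.
  have [|||s2 x2 e2] := @exec_copy a n n.+3 s1; [lia..|].
  have [s3 x3 e3] := exec_clear n.+1 s2.
  (* Loop invariant: registers [n] and [n.+1] add up to the recursion argument, and [n.+2] holds [r]
     at the value of [n.+1]. *)
  have [s4 x4 [e4 e4']] : exists2 s4,
      exec (Loop n (Seq (compile g [:: n.+1, n.+2 & ins] n.+3 n.+4)
                        (Seq (move n.+3 n.+2) (Inc n.+1)))) s3 s4 &
      s4 n.+2 = y /\ forall i, i < n -> s4 i = s i.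
    have s3lt i : i < n -> s3 i = s i.
      by move=> lti; rewrite e3 /upd e2 -(e1' i); [upd_cases|lia..].
    have s3n : s3 n + s3 n.+1 = s a.
      by rewrite !e3 /upd !e2 -(e1' a); [upd_cases|lia..].
    have s3n2 : s3 n.+2 = r (s3 n.+1).
      by rewrite !e3 /upd !e2; upd_cases.
    have [k sk] : exists k, s3 n = k by exists (s3 n).
    elim: k s3 sk s3lt s3n2 s3n {x3 e3} => [|k IH] s3 sk s3lt s3n2 s3n.
      exists s3; first exact: exec_loop0.
      by rewrite s3n2 -ry -s3n sk.
    set t0 := upd s3 n k.
    have [|||||t1 y1 [d1 d1']] := cg _ _ t0 [:: n.+1, n.+2 & ins] n.+3 n.+4 (rg (s3 n.+1) _).
    + by rewrite -s3n sk; lia.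
    + rewrite /= {1 2}/t0 -s3n2; congr [:: _, _ & _]; try by upd_cases.
      by apply/eq_in_map => i /insn lti; rewrite -s3lt // /t0; upd_cases.
    + by rewrite /= !ltnS; apply/andP; split; [lia|]; apply/andP; split; [lia|];
        apply/allP => i /insn /=; lia.
    + by [].
    + by rewrite !inE !negb_or; apply/and3P; split; [lia..|apply/negP => /insn; lia].
    have [|t2 y2 d2] := @exec_move n.+3 n.+2 t1; first by lia.
    have t2E i : i <= n.+1 -> t2 i = t0 i.
      by move=> lei; rewrite d2 -(d1' i); [upd_cases|lia..].
    have [||||s4 x4 P4] := IH (upd t2 n.+1 (t2 n.+1).+1).
    + by rewrite /upd !t2E // /t0; upd_cases.
    + by move=> i lti; rewrite /upd !t2E -?s3lt /t0; [upd_cases|lia..].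
    + by rewrite /upd t2E // d2 /t0; upd_cases.
    + by rewrite /upd !t2E // /t0; upd_cases.
    exists s4 => //; apply: exec_loopS sk _ x4.
    exact: exec_seq y1 (exec_seq y2 (exec_inc _ _)).
  have [|s5 x5 e5] := @exec_move n.+2 out s4; first by lia.
  exists s5.
    exact: exec_seq (exec_seq x1 (exec_seq x2 x3)) (exec_seq x4 x5).
  split=> [|i lti ni]; first by rewrite e5 -e4; upd_cases.
  by rewrite e5 -e4' //; upd_cases.
- move=> xs y s ins out n ev xsE insn lto nin.
  inversion ev as [| | | | | |? ? ? ev0 evS]; subst f0 xs0 n0.
  have {}insn i : i \in ins -> i < n by move/(allP insn).
  have run t z : (forall i, i < n -> t i = s i) -> reval f (t n :: xs) z ->
      exists2 t', exec (compile f (n :: ins) n.+1 n.+2) t t' &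
        [/\ t' n.+1 = z, t' n = t n & forall i, i < n -> t' i = s i].
    move=> tE evz; have [||||t' xt [h1 h2]] := cf _ _ t (n :: ins) n.+1 n.+2 evz.
    + by rewrite xsE /=; congr cons; apply/eq_in_map => i /insn /tE.
    + by rewrite /=; apply/andP; split; [lia|apply/allP => i /insn /=; lia].
    + by lia.
    + by rewrite inE negb_or; apply/andP; split; [lia|apply/negP => /insn; lia].
    exists t' => //; split=> // [|i lti]; first by apply: h2; lia.
    by rewrite h2 ?tE; lia.
  have [s1 x1 e1] := exec_clear n s.
  have s1E i : i < n -> s1 i = s i by move=> lti; rewrite e1; upd_cases.
  have s1n : s1 n = 0 by rewrite e1; upd_cases.
  (* Both premises of [ev_mu] in one form: up to [y], the value of [f] is zero exactly at [y]. *)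
  have evE m : m <= y -> exists z, reval f (m :: xs) z /\ (z == 0) = (m == y).
    rewrite leq_eqVlt => /predU1P[->|ltm]; first by exists 0; rewrite !eqxx.
    by have [k ek] := evS _ ltm; exists k.+1; rewrite (ltn_eqF ltm).
  have [|z [evz zP]] := evE (s1 n); first by rewrite s1n.
  have [s2 x2 [h1 h2 h3]] := run _ _ s1E evz.
  (* Induction on the distance from the candidate to [y]; the tested register is zero exactly when
     the candidate is [y]. *)
  have [s3 x3 [e3 e3']] : exists2 s3,
      exec (Loop n.+1 (Seq (Inc n) (compile f (n :: ins) n.+1 n.+2))) s2 s3 &
      s3 n = y /\ forall i, i < n -> s3 i = s i.
    have s2le : s2 n <= y by rewrite h2 s1n.
    have {h1 h2} s2P : (s2 n.+1 == 0) = (s2 n == y) by rewrite h2 h1.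
    have [k sk] : exists k, y - s2 n = k by exists (y - s2 n).
    elim: k s2 sk s2le s2P h3 {x2} => [|k IH] s2 sk s2le s2P h3.
      have s2y : s2 n = y by lia.
      exists s2; last by [].
      by apply: exec_loop0; apply/eqP; rewrite s2P s2y.
    have [w wE] : exists w, s2 n.+1 = w.+1 by exists (s2 n.+1).-1; lia.
    set t := upd s2 n.+1 w; set t1 := upd t n (t n).+1.
    have t1n : t1 n = (s2 n).+1 by rewrite /t1 /t; upd_cases.
    have t1E i : i < n -> t1 i = s i.
      by move=> lti; rewrite /t1 /t -h3 //; upd_cases.
    have [|z1 [evz1 z1P]] := evE (t1 n); first by lia.
    have [t2 y2 [d1 d2 d3]] := run _ _ t1E evz1.
    have [||||s3 x3 P3] := IH t2; [by lia..|by rewrite d1 d2|by []|].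
    exists s3 => //; apply: exec_loopS wE _ x3.
    exact: exec_seq (exec_inc _ _) y2.
  have [|s4 x4 e4] := @exec_move n out s3; first by lia.
  exists s4; first exact: exec_seq (exec_seq x1 x2) (exec_seq x3 x4).
  split=> [|i lti ni]; first by rewrite e4 -e3; upd_cases.
  by rewrite e4 -e3' //; upd_cases.
Qed.

(** * Rotating programs *)

(* Programs on a list of registers that only see the front one. [RLoop] moves
   the tested register to the back only when it finds it zero, since a queue
   cannot be inspected without dequeuing. *)
Inductive rprog :=
| Rot
| IncRot
| RSeq of rprog & rprog
| RLoop of rprog.

Inductive rexec : rprog -> seq nat -> seq nat -> Prop :=
| rexec_rot c cs : rexec Rot (c :: cs) (rcons cs c)
| rexec_inc c cs : rexec IncRot (c :: cs) (rcons cs c.+1)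
| rexec_seq P Q c c1 c2 : rexec P c c1 -> rexec Q c1 c2 -> rexec (RSeq P Q) c c2
| rexec_loop0 P cs : rexec (RLoop P) (0 :: cs) (rcons cs 0)
| rexec_loopS P c cs d d' :
    rexec P (c :: cs) d -> rexec (RLoop P) d d' -> rexec (RLoop P) (c.+1 :: cs) d'.

Definition rot_before n P := iter n (RSeq Rot) P.
Definition rot_after n P := iter n (fun Q => RSeq Q Rot) P.

Lemma rexec_rot1 c : 0 < size c -> rexec Rot c (rot 1 c).
Proof. by case: c => // a c _; rewrite rot1_cons; apply: rexec_rot. Qed.

Lemma rexec_before n P c d :
  n <= size c -> rexec P (rot n c) d -> rexec (rot_before n P) c d.
Proof.
elim: n c => [|n IH] c lec /=; first by rewrite rot0.
rewrite -addn1 rotD ?addn1 // => xP; apply: rexec_seq (rexec_rot1 _) _.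
  exact: leq_trans lec.
by apply: IH; rewrite // size_rot ltnW.
Qed.

Lemma rexec_after n P c d :
  n <= size d -> rexec P c d -> rexec (rot_after n P) c (rot n d).
Proof.
elim: n => [|n IH] lec xP /=; first by rewrite rot0.
apply: rexec_seq (IH (ltnW lec) xP) _.
rewrite -add1n rotD ?add1n //.
by apply: rexec_rot1; rewrite size_rot; apply: leq_trans lec.
Qed.

Fixpoint bound (P : prog) : nat :=
  match P with
  | Skip => 1
  | Inc i => i.+1
  | Seq P Q => maxn (bound P) (bound Q)
  | Loop i P => maxn i.+1 (bound P)
  end.

(** Every piece starts and ends with register 0 in front, so [Skip] is a full turn. The body of a
    loop is entered with register [i] in front, hence the [r - i] rotations before it and the [i]
    after it. *)
Fixpoint rotating (r : nat) (P : prog) : rprog :=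
  match P with
  | Skip => rot_after r.-1 Rot
  | Inc i => rot_before i (rot_after (r - i.+1) IncRot)
  | Seq P Q => RSeq (rotating r P) (rotating r Q)
  | Loop i P => rot_before i (rot_after (r - i.+1)
                  (RLoop (rot_before (r - i) (rot_after i (rotating r P)))))
  end.

Section Rotating.
Variable r : nat.

Definition others i (s : nat -> nat) :=
  [seq s j | j <- iota i.+1 (r - i.+1)] ++ [seq s j | j <- iota 0 i].

Lemma rot_mkseq i s : i < r -> rot i (mkseq s r) = s i :: others i s.
Proof.
move=> ltir; rewrite /rot /mkseq -map_drop -map_take drop_iota take_iota.
rewrite (minn_idPl (ltnW ltir)) add0n.
by have -> : r - i = (r - i.+1).+1 by lia.
Qed.

Lemma others_upd i s v : others i (upd s i v) = others i s.
Proof.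
rewrite /others; congr cat; apply/eq_in_map => j; rewrite mem_iota => jP;
  by rewrite /upd; case: eqP jP => //; lia.
Qed.

Lemma rot_mkseq_upd i s v : i < r -> rot i (mkseq (upd s i v) r) = v :: others i s.
Proof. by move=> ltir; rewrite rot_mkseq // others_upd /upd eqxx. Qed.

Lemma rot_back i (c : seq nat) : i < r -> size c = r -> rot (r - i.+1) (rot 1 (rot i c)) = c.
Proof.
move=> ltir sc; rewrite -rotD ?size_rot ?sc; last by lia.
have -> : r - i.+1 + 1 = r - i by lia.
rewrite -rotD ?sc; last by lia.
by rewrite subnK ?(ltnW ltir) // -sc rot_size.
Qed.

Lemma exec_rotating P s s' : exec P s s' -> bound P <= r ->
  rexec (rotating r P) (mkseq s r) (mkseq s' r).
Proof.
move=> xP.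
(* A further pass re-enters a loop with register [i] in front, inside the outer rotations; for loops
   the induction therefore also carries the statement in that rotated position. *)
suff: bound P <= r -> rexec (rotating r P) (mkseq s r) (mkseq s' r) /\
    (if P is Loop i Q then
       rexec (RLoop (rot_before (r - i) (rot_after i (rotating r Q))))
             (rot i (mkseq s r)) (rot 1 (rot i (mkseq s' r)))
     else True) by move=> H /H[].
have loopP i Q s0 s1 : i < r ->
    rexec (RLoop Q) (rot i (mkseq s0 r)) (rot 1 (rot i (mkseq s1 r))) ->
    rexec (rot_before i (rot_after (r - i.+1) (RLoop Q))) (mkseq s0 r) (mkseq s1 r).
  move=> ltir xQ; apply: rexec_before; first by rewrite size_mkseq ltnW.
  rewrite -(@rot_back i (mkseq s1 r)) ?size_mkseq //.
  by apply: rexec_after => //; rewrite !size_rot size_mkseq; lia.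
elim: P s s' / xP => [s|i s|P Q s s1 s2 _ IH1 _ IH2|i P s si0|i P s n s1 s2 sin _ IH1 _ IH2] /=.
- move=> lt0r; split=> //; rewrite -{2}(@rot_back 0 (mkseq s r)) ?size_mkseq //.
  rewrite rot0 subn1; apply: rexec_after; first by rewrite size_rot size_mkseq leq_pred.
  by apply: rexec_rot1; rewrite size_mkseq.
- move=> ltir; split=> //; apply: rexec_before; first by rewrite size_mkseq ltnW.
  rewrite -(@rot_back i (mkseq (upd s i (s i).+1) r)) ?size_mkseq //.
  apply: rexec_after; first by rewrite !size_rot size_mkseq; lia.
  by rewrite rot_mkseq_upd // rot_mkseq // rot1_cons; apply: rexec_inc.
- rewrite geq_max => /andP[/IH1[x1 _] /IH2[x2 _]]; split=> //.
  exact: rexec_seq x1 x2.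
- rewrite geq_max => /andP[ltir _].
  have x0 : rexec (RLoop (rot_before (r - i) (rot_after i (rotating r P))))
             (rot i (mkseq s r)) (rot 1 (rot i (mkseq s r))).
    by rewrite rot_mkseq // si0 rot1_cons; apply: rexec_loop0.
  by split=> //; apply: loopP.
- rewrite geq_max => /andP[ltir leP]; have [x1 _] := IH1 leP.
  have [|_ x2] := IH2; first by rewrite geq_max ltir.
  suff x : rexec (RLoop (rot_before (r - i) (rot_after i (rotating r P))))
             (rot i (mkseq s r)) (rot 1 (rot i (mkseq s2 r))).
    by split=> //; apply: loopP.
  rewrite rot_mkseq // sin; apply: rexec_loopS x2.
  rewrite -(rot_mkseq_upd s n ltir); apply: rexec_before.
    by rewrite size_rot size_mkseq leq_subr.
  rewrite -rotD; last by rewrite size_mkseq subnK ?(ltnW ltir).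
  rewrite subnK ?(ltnW ltir) // rot_oversize ?size_mkseq //.
  by apply: rexec_after; rewrite ?size_mkseq // ltnW.
Qed.

End Rotating.

(** * Queue automata *)

(* A local transition [(p, w, b, q)] goes from [p] to [q] by writing the letter
   [b] at the back of the queue if [w], and by reading it at the front otherwise. *)
Definition ltrans : Type := (nat * bool * bool * nat)%type.

Inductive lstep (A : seq ltrans) : nat * seq bool -> nat * seq bool -> Prop :=
| lstep_write p b p' w : (p, true, b, p') \in A -> lstep A (p, w) (p', rcons w b)
| lstep_read p b p' w : (p, false, b, p') \in A -> lstep A (p, b :: w) (p', w).

Notation lsteps A := (clos_refl_trans _ (lstep A)).

Inductive lpath (A : seq ltrans) : nat -> seq (bool * bool) -> nat -> Prop :=
| lpath_nil p : lpath A p [::] p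
| lpath_cons p w b p' l q :
    (p, w, b, p') \in A -> lpath A p' l q -> lpath A p ((w, b) :: l) q.

Lemma lpath_rcons A p l q w b q' :
  lpath A p l q -> (q, w, b, q') \in A -> lpath A p (rcons l (w, b)) q'.
Proof.
move=> pl Aq; elim: p l q / pl Aq => [p|p w0 b0 p1 l q A0 _ IH] /= Aq.
  by apply: lpath_cons Aq _; apply: lpath_nil.
by apply: lpath_cons A0 (IH Aq).
Qed.

Definition word (w : bool) (l : seq (bool * bool)) : seq bool :=
  [seq x.2 | x <- l & x.1 == w].

(** A state may read both letters, the queue choosing between them, but it may write only one. *)
Definition ldet (A : seq ltrans) := forall p w b q w' b' q',
  (p, w, b, q) \in A -> (p, w', b', q') \in A ->
  [/\ w = w', w -> b = b' & b = b' -> q = q'].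

(* A path whose written and read words agree need not be causal, but
   determinism forces it to follow the genuine queue computation. *)
Lemma ldet_no_path A p w p1 w1 f l :
  ldet A -> lsteps A (p, w) (p1, w1) ->
  (forall x b q, (p1, x, b, q) \notin A) ->
  (forall x b q, (f, x, b, q) \in A -> q = f) -> p1 != f ->
  lpath A p l f -> w ++ word true l <> word false l.
Proof.
move=> dA /(clos_rt_rt1n _ _ _ _) run stuck loop nf.
(* [f] is absorbing, so a run that ends in [p1], other than [f], never visits [f]. *)
have absorb g h : clos_refl_trans_1n _ (lstep A) g h -> g.1 = f -> h.1 = f.
  elim=> // {}g g' {}h st _ IH gf; apply: IH.
  by case: st gf => q b q' v Aq /= qf; subst q; apply: loop Aq.
have [g gE] : exists g, g = (p, w) by exists (p, w).
have [h hE] : exists h, h = (p1, w1) by exists (p1, w1).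
rewrite -gE -hE in run; elim: run p w l gE hE => [g'|g1 g2 g3 st run IH] p w l gE hE pl.
  rewrite hE in gE; case: gE => pE _; rewrite -{}pE in pl.
  inversion pl as [|? ? ? ? ? ? Ax]; subst; first by rewrite eqxx in nf.
  by rewrite (negPf (stuck _ _ _)) in Ax.
have nl : p <> f.
  move=> pf; have := absorb _ _ (Relation_Operators.rt1n_trans _ _ _ _ _ st run).
  by rewrite gE hE /= => /(_ pf) /eqP; rewrite (negPf nf).
inversion pl as [|? x b p' l' ? Ax pl']; subst; first by [].
(* The run and the path leave the same state. A write is forced; for a read, the assumed equality of
   words gives the path the letter at the front of the queue. *)
inversion st as [q c q' v Aq|q c q' v Aq]; subst.
- have [xE bE qE] := dA _ _ _ _ _ _ _ Aq Ax.
  subst x; rewrite -(bE isT) in Ax pl *; have {}qE := qE (bE isT); subst q'.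
  rewrite /word /= -/(word _ _) -cat_rcons; exact: IH pl'.
- have [xE _ qE] := dA _ _ _ _ _ _ _ Aq Ax; subst x.
  rewrite /word /= -/(word _ _) => -[cb]; have {}qE := qE cb; subst q'.
  exact: IH pl'.
Qed.

(** * Addressed code for rotating programs *)

Inductive instr := Enq of bool & nat | Deq of nat & nat | Stop.

Definition acts (i : instr) : seq (bool * bool * nat) :=
  match i with
  | Enq b q => [:: (true, b, q)]
  | Deq q0 q1 => [:: (false, false, q0); (false, true, q1)]
  | Stop => [::]
  end.

Definition ltrans_of (T : seq instr) : seq ltrans :=
  flatten [seq [seq (p, a.1.1, a.1.2, a.2) | a <- acts (nth Stop T p)]
          | p <- iota 0 (size T)].

Lemma mem_ltrans_of T p w b q :
  ((p, w, b, q) \in ltrans_of T) = ((w, b, q) \in acts (nth Stop T p)).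
Proof.
apply/flatten_mapP/idP => [[p0 _ /mapP[[[w0 b0] q0] a0 /= [-> -> -> ->]]]//|a].
exists p; last by apply/mapP; exists (w, b, q).
by rewrite mem_iota /= add0n ltnNge; apply: contraL a => le; rewrite nth_default.
Qed.

(** An address holds a single instruction, and the two branches of [Deq] differ in their letter. *)
Lemma ldet_ltrans_of T : ldet (ltrans_of T).
Proof.
move=> p w b q w' b' q'; rewrite !mem_ltrans_of.
case: (nth Stop T p) => [c x|x y|] //=; rewrite !inE.
  by move=> /eqP[-> -> ->] /eqP[-> -> ->].
by move=> /orP[] /eqP[-> -> ->] /orP[] /eqP[-> -> ->].
Qed.

(** [Stop] has no actions, so the default value of [nth] demands nothing beyond the end of [cs]. *)
Definition has_code (A : seq ltrans) (e : nat) (cs : seq instr) :=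
  forall i w b q, (w, b, q) \in acts (nth Stop cs i) -> (e + i, w, b, q) \in A.

Lemma has_code_cat A e cs1 cs2 :
  has_code A e (cs1 ++ cs2) -> has_code A e cs1 /\ has_code A (e + size cs1) cs2.
Proof.
move=> h; split=> i w b q a; last first.
  by rewrite -addnA; apply: h; rewrite nth_cat ltnNge leq_addr addKn.
by apply: h; rewrite nth_cat; case: ltnP a => // le; rewrite nth_default.
Qed.

Lemma has_code_cons A e i cs :
  has_code A e (i :: cs) ->
  (forall w b q, (w, b, q) \in acts i -> (e, w, b, q) \in A) /\ has_code A e.+1 cs.
Proof.
move=> h; split=> [w b q /(h 0)|j w b q /(h j.+1)]; first by rewrite addn0.
by rewrite addSnnS.
Qed.

Fixpoint csize (P : rprog) : nat :=
  match P with
  | Rot => 3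
  | IncRot => 4
  | RSeq P Q => csize P + csize Q
  | RLoop P => (csize P).+2
  end.

(* Code for [P], loaded at address [e] and leaving at address [x]. *)
Fixpoint code (P : rprog) (e x : nat) : seq instr :=
  match P with
  | Rot => [:: Deq e.+2 e.+1; Enq true e; Enq false x]
  | IncRot => [:: Deq e.+2 e.+1; Enq true e; Enq true e.+3; Enq false x]
  | RSeq P Q => code P e (e + csize P) ++ code Q (e + csize P) x
  | RLoop P => [:: Deq e.+1 e.+2, Enq false x & code P e.+2 e]
  end.

Lemma size_code P e x : size (code P e x) = csize P.
Proof. by elim: P e x => //= [P IHP Q IHQ|P IH] e x; rewrite ?size_cat ?IHP ?IHQ ?IH. Qed.

(** With [false] closing each block, reading one letter tests a register for zero and, on [true],
    has already decremented it. *)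
Definition enc (c : seq nat) : seq bool :=
  flatten [seq rcons (nseq n true) false | n <- c].

Lemma enc_cons n c : enc (n :: c) = nseq n true ++ false :: enc c.
Proof. by rewrite /enc /= cat_rcons. Qed.

Lemma enc_rcons c n : enc (rcons c n) = enc c ++ rcons (nseq n true) false.
Proof. by rewrite /enc map_rcons flatten_rcons. Qed.

Lemma lsteps_write A p b p' w w' :
  (p, true, b, p') \in A -> w' = rcons w b -> lsteps A (p, w) (p', w').
Proof. by move=> Ap ->; apply: rt_step; apply: lstep_write. Qed.

Lemma lsteps_read A p b p' w :
  (p, false, b, p') \in A -> lsteps A (p, b :: w) (p', w).
Proof. by move=> Ap; apply: rt_step; apply: lstep_read. Qed.

Lemma lsteps_copy A e e' n w :
  (e, false, true, e.+1) \in A -> (e.+1, true, true, e) \in A ->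
  (e, false, false, e') \in A ->
  lsteps A (e, nseq n true ++ false :: w) (e', w ++ nseq n true).
Proof.
move=> A1 A2 A3; elim: n w => [|n IH] w /=.
  by rewrite cats0; apply: lsteps_read.
apply: rt_trans (lsteps_read _ A1) _.
apply: rt_trans (lsteps_write A2 (erefl _)) _.
by have := IH (rcons w true); rewrite rcons_cat cat_rcons.
Qed.

Lemma code_lsteps A P e x c d :
  rexec P c d -> has_code A e (code P e x) -> lsteps A (e, enc c) (x, enc d).
Proof.
move=> xP; elim: P c d / xP e x =>
  [c cs|c cs|P Q c c1 c2 _ IH1 _ IH2|P cs|P c cs d d' _ IH1 _ IH2] e x.
- move=> /has_code_cons[i0 /has_code_cons[i1 /has_code_cons[i2 _]]].
  rewrite enc_rcons enc_cons.
  apply: rt_trans (lsteps_copy (e' := e.+2) _ _ _ _ _) _.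
  + by apply: i0; rewrite !inE eqxx ?orbT.
  + by apply: i1; rewrite !inE eqxx.
  + by apply: i0; rewrite !inE eqxx.
  by apply: lsteps_write (i2 _ _ _ (mem_head _ _)) _; rewrite rcons_cat.
- move=> /has_code_cons[i0 /has_code_cons[i1 /has_code_cons[i2 /has_code_cons[i3 _]]]].
  rewrite enc_rcons enc_cons.
  apply: rt_trans (lsteps_copy (e' := e.+2) _ _ _ _ _) _.
  + by apply: i0; rewrite !inE eqxx ?orbT.
  + by apply: i1; rewrite !inE eqxx.
  + by apply: i0; rewrite !inE eqxx.
  apply: rt_trans (lsteps_write (i2 _ _ _ (mem_head _ _)) (erefl _)) _.
  apply: lsteps_write (i3 _ _ _ (mem_head _ _)) _.
  by rewrite !rcons_cat -(cats1 (nseq c true)) -(nseqD c 1) addn1.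
- rewrite /= => /has_code_cat[h1]; rewrite size_code => h2.
  exact: rt_trans (IH1 _ _ h1) (IH2 _ _ h2).
- move=> /has_code_cons[i0 /has_code_cons[i1 _]]; rewrite enc_rcons.
  apply: rt_trans (lsteps_read _ (i0 _ _ _ (mem_head _ _))) _.
  by apply: lsteps_write (i1 _ _ _ (mem_head _ _)) _; rewrite cats1.
- move=> h; have [i0 /has_code_cons[_ hP]] := has_code_cons h.
  apply: rt_trans (lsteps_read _ (i0 false true e.+2 _)) _; first by rewrite !inE eqxx orbT.
  exact: rt_trans (IH1 _ _ hP) (IH2 _ _ h).
Qed.

(* Addresses: 0 accepts and empties the queue, 1 rejects, 2 is the entry point,
   reached with the queue containing the input register only. *)
Definition machine (r : nat) (P : rprog) : seq instr :=
  [:: Deq 0 0; Stop] ++ [seq Enq false i.+1 | i <- iota 2 r]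
  ++ code P (r + 2) (r + 2 + csize P) ++ [:: Deq 0 1].

Lemma machine_run A r P x y cs :
  has_code A 0 (machine r P) -> rexec P (x :: nseq r 0) (y :: cs) ->
  lsteps A (2, rcons (nseq x true) false)
    (if y is y'.+1 then (1, enc (y' :: cs)) else (0, [::])).
Proof.
move=> /has_code_cat[h0 /has_code_cat[h1 /has_code_cat[h2 h3]]] xP.
rewrite size_code in h3; rewrite size_map size_iota /= addnC in h2 h3.
apply: (@rt_trans _ _ _ (r + 2, enc (x :: nseq r 0))).
  (* Here [c] zero registers have been appended and [n] remain. *)
  have: forall n c, n <= r -> c = r - n ->
     has_code A (2 + c) [seq Enq false i.+1 | i <- iota (2 + c) n] ->
     lsteps A (2 + c, enc (x :: nseq c 0)) (r + 2, enc (x :: nseq r 0)).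
    elim=> [|n IH] c len cE; first by rewrite cE subn0 addnC => _; apply: rt_refl.
    move=> /has_code_cons[i0 /= i1]; apply: rt_trans (IH c.+1 _ _ _); first last.
    - by rewrite addnS.
    - by lia.
    - by lia.
    apply: lsteps_write; first by rewrite addnS; apply: i0; rewrite inE.
    by rewrite -[c.+1]addn1 nseqD cats1 -rcons_cons enc_rcons cats1.
  by move/(_ r 0 (leqnn _)); rewrite subnn addn0 {1}enc_cons cats1; apply.
apply: (rt_trans _ _ _ _ _ (code_lsteps xP h2)).
have [i3 _] := has_code_cons h3; case: y {xP} => [|y]; rewrite enc_cons.
  apply: rt_trans (lsteps_read _ (i3 _ _ _ (mem_head _ _))) _.
  have [i0 _] := has_code_cons h0.
  (* Stability asks for empty channels, so the accepting state 0 reads whatever is left. *)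
  elim: (enc cs) => [|b w IH]; first exact: rt_refl.
  by apply: rt_trans (lsteps_read _ (i0 false b 0 _)) IH; case: b; rewrite !inE eqxx ?orbT.
by rewrite enc_cons; apply: lsteps_read; apply: i3; rewrite !inE eqxx orbT.
Qed.

(* The controller first writes its input [x] in unary. *)
Fixpoint load (x n : nat) : seq ltrans :=
  if n is n'.+1 then (x + n, true, true, x + n') :: load x n'
  else [:: (x, true, false, 2)].

Lemma mem_load x n p w b q :
  (p, w, b, q) \in load x n ->
  (p = x /\ (w, b, q) = (true, false, 2)) \/
  exists m, [/\ m < n, p = x + m.+1 & (w, b, q) = (true, true, x + m)].
Proof.
elim: n => [|n IH] /=; first by rewrite inE => /eqP[-> -> -> ->]; left.
rewrite inE => /predU1P[[-> -> -> ->]|/IH[?|[m [ltm -> ->]]]]; first by right; exists n.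
  by left.
by right; exists m; split=> //; apply: ltnW.
Qed.

(** The loader occupies the states from [x] to [x + x]. The other part does not depend on [x], so
    [x] may be chosen as the code of that part. *)
Definition controller (x : nat) (T : seq instr) : seq ltrans := load x x ++ ltrans_of T.

Section Controller.
Variables (x : nat) (T : seq instr).
Hypothesis Tx : forall p w b q, (p, w, b, q) \in ltrans_of T -> p < x.

(** By [Tx], the states of [T] lie below those of the loader, so the two parts share no source
    state. *)
Lemma ldet_controller : ldet (controller x T).
Proof.
move=> p w b q w' b' q'; rewrite !mem_cat.
move=> /orP[/mem_load H|H] /orP[/mem_load H'|H'].
- case: H H' => [[-> [-> -> ->]]|[m [_ -> [-> -> ->]]]] [[e [-> -> ->]]|[m' [_ e [-> -> ->]]]] //.
  + by lia.
  + by lia.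
  by have -> : m' = m by lia.
- by have := Tx H'; case: H => [[-> _]|[m [_ -> _]]]; lia.
- by have := Tx H; case: H' => [[-> _]|[m [_ -> _]]]; lia.
- exact: ldet_ltrans_of H H'.
Qed.

Lemma load_run : lsteps (controller x T) (x + x, [::]) (2, rcons (nseq x true) false).
Proof.
have: forall n w, {subset load x n <= controller x T} ->
    lsteps (controller x T) (x + n, w) (2, rcons (w ++ nseq n true) false).
  elim=> [|n IH] w sub.
    by rewrite addn0 cats0; apply: lsteps_write => //; apply: sub; rewrite inE.
  apply: rt_trans (lsteps_write (sub _ (mem_head _ _)) (erefl _)) _.
  by rewrite -cat_rcons; apply: IH => t ht; apply: sub; rewrite inE ht orbT.
by apply=> t ht; rewrite mem_cat ht.
Qed.

End Controller.

Lemma has_code_controller x T : has_code (controller x T) 0 T.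
Proof. by move=> i w b q a; rewrite mem_cat mem_ltrans_of add0n a orbT. Qed.

(** * Simulating a queue on a cycle *)

(** [fw i] tells whether [e i] points along the traversal. Asking for [fw 0] makes [e 0] leave
    [v 0], so that its channel can store the queue written by the controller. *)
Definition oriented_cycle (N E : finType) (tl hd : E -> N)
    (k : nat) (e : nat -> E) (v : nat -> N) (fw : nat -> bool) :=
  [/\ forall i j, i <= k -> j <= k -> e i = e j -> i = j,
      forall i j, i <= k -> j <= k -> v i = v j -> i = j,
      v k.+1 = v 0, fw 0 &
      forall i, i <= k ->
        (tl (e i), hd (e i)) = if fw i then (v i, v i.+1) else (v i.+1, v i)].

(* Rotate the cycle to a forward edge if there is one, else reverse it. *)
Lemma has_oriented_cycle (N E : finType) (tl hd : E -> N) :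
  undirected_has_cycle tl hd -> exists k e v fw, oriented_cycle tl hd k e v fw.
Proof.
case=> k [es [vs [es_inj [vs_inj join]]]].
pose o n : 'I_k.+1 := inord (n %% k.+1).
have o_inj n m : o n = o m -> n = m %[mod k.+1].
  by move/(congr1 val); rewrite /= !inordK ?ltn_mod.
have oS n : ordS (o n) = o n.+1.
  by apply: val_inj; rewrite /= !inordK ?ltn_mod // -[in RHS]addn1 -modnDml addn1.
have modsmall n m : n <= k -> m <= k -> n = m %[mod k.+1] -> n = m.
  by move=> ln lm; rewrite !modn_small.
pose fwd n := (tl (es (o n)) == vs (o n)) && (hd (es (o n)) == vs (o n.+1)).
have joinF n : (tl (es (o n)), hd (es (o n))) =
    if fwd n then (vs (o n), vs (o n.+1)) else (vs (o n.+1), vs (o n)).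
  rewrite /fwd -oS; case: andP => [[/eqP-> /eqP->]//|nf].
  by case: (join (o n)) => -[h1 h2]; [case: nf; rewrite h1 h2 !eqxx | rewrite h1 h2].
have [[f ff]|nofwd] : (exists f, fwd f) \/ forall n, fwd n = false.
  case: (boolP [exists i : 'I_k.+1, fwd i]) => [/existsP[i fi]|/existsPn nf].
    by left; exists i.
  right=> n; have on i : o (i %% k.+1) = o i by rewrite /o modn_mod.
  have := nf (o n); rewrite /fwd -!oS /= inordK ?ltn_mod // !on; exact: negPf.
- exists k, (fun i => es (o (f + i))), (fun i => vs (o (f + i))), (fun i => fwd (f + i)).
  split=> [i j li lj /es_inj /o_inj /eqP|i j li lj /vs_inj /o_inj /eqP||//|i li].
  + by rewrite eqn_modDl => /eqP /modsmall; apply.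
  + by rewrite eqn_modDl => /eqP /modsmall; apply.
  + by rewrite addn0 /o modnDr.
  + by rewrite addn0.
  + by rewrite addnS; apply: joinF.
(* Walking backwards makes every edge forward. The old edge [k - i] joins the old vertices
   [k.+1 - i] and [k - i], whence the shift by one. *)
- exists k, (fun i => es (o (k - i))), (fun i => vs (o (k.+1 - i))), (fun=> true).
  split=> [i j li lj /es_inj /o_inj /modsmall|i j li lj /vs_inj /o_inj /eqP|||i li] //.
  + by move=> H; have := H (leq_subr _ _) (leq_subr _ _); lia.
  (* Adding [i + j] turns the truncated differences into sums. *)
  + rewrite -(eqn_modDr (i + j)).
    have -> : k.+1 - i + (i + j) = j + k.+1 by lia.
    have -> : k.+1 - j + (i + j) = i + k.+1 by lia.
    by rewrite !modnDr => /eqP /modsmall ->.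
  + by rewrite subnn subn0 /o modnn mod0n.
  + by have := joinF (k - i); rewrite nofwd subSS subSn.
Qed.

Section Ring.
Variables (N E : finType) (tl hd : E -> N).
Variables (k : nat) (e : nat -> E) (v : nat -> N) (fw : nat -> bool).
Hypothesis cyc : oriented_cycle tl hd k e v fw.

Let e_inj i j : i <= k -> j <= k -> e i = e j -> i = j.
Proof. by case: cyc => + _ _ _ _; apply. Qed.
Let v_inj i j : i <= k -> j <= k -> v i = v j -> i = j.
Proof. by case: cyc => _ + _ _ _; apply. Qed.
Let v_last : v k.+1 = v 0. Proof. by case: cyc. Qed.
Let fw0 : fw 0. Proof. by case: cyc. Qed.
Let joins i : i <= k ->
  (tl (e i), hd (e i)) = if fw i then (v i, v i.+1) else (v i.+1, v i).
Proof. by case: cyc => _ _ _ _; apply. Qed.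

Let eqv i j : i <= k -> j <= k -> (v i == v j) = (i == j).
Proof. by move=> li lj; apply/eqP/eqP => [/v_inj->|->]. Qed.
Let eqe i j : i <= k -> j <= k -> (e i == e j) = (i == j).
Proof. by move=> li lj; apply/eqP/eqP => [/e_inj->|->]. Qed.

(** Parity gives the letter and the half gives the edge, so distinct edges have disjoint message
    sets. *)
Definition msg (xi : E) (b : bool) : nat := (enum_rank xi).*2 + b.

Lemma msg_inj xi b zeta c : msg xi b = msg zeta c -> xi = zeta /\ b = c.
Proof.
rewrite /msg => h; have rE : enum_rank xi = enum_rank zeta.
  by apply: val_inj => /=; case: b c h => -[] /=; lia.
by split; [apply: enum_rank_inj | case: b c h => -[] //; rewrite rE; lia].
Qed.

Definition prev (i : nat) := if i is i'.+1 then i' else k.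
Definition next (i : nat) := if i == k then 0 else i.+1.

Lemma prev_le i : i <= k -> prev i <= k. Proof. by case: i => //= i /ltnW. Qed.
Lemma prevK i : i <= k -> next (prev i) = i.
Proof. by rewrite /next; case: i => [|i] /=; rewrite ?eqxx // => lti; rewrite ltn_eqF. Qed.
Lemma nextK i : i <= k -> prev (next i) = i.
Proof. by rewrite /next; case: eqP => [->|]. Qed.
Lemma v_prevS i : i <= k -> v (prev i).+1 = v i. Proof. by case: i. Qed.

(* Node [i] writes on its outer edge [e i] and reads on [e (prev i)]; whether
   that is a send or a receive depends on the orientation of the edge. *)
Definition side (i : nat) (w : bool) : E := if w then e i else e (prev i).
Definition sends (i : nat) (w : bool) : bool := if w then fw i else ~~ fw (prev i).
Definition globalize (i : nat) (t : ltrans) : nat * bool * nat * nat :=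
  let: (p, w, b, q) := t in (p, sends i w, msg (side i w) b, q).

Lemma sends_endpoint i w : i <= k ->
  if sends i w then tl (side i w) = v i else hd (side i w) = v i.
Proof.
rewrite /sends /side => li; case: w.
  by have := joins li; case: (fw i) => -[].
by have := joins (prev_le li); rewrite v_prevS //; case: (fw _) => -[].
Qed.

(** State 0 is idle and state [b.+1] holds the letter [b]. If [fw i] fails, the write is a receive
    from [e i]; it comes first and fixes the letter to be passed on. *)
Definition relay (i : nat) : seq ltrans :=
  flatten [seq [:: (0, ~~ fw i, b, (nat_of_bool b).+1);
                   ((nat_of_bool b).+1, fw i, b, 0)]
          | b : bool <- [:: false; true]].

Variables (A : seq ltrans) (n0 i0 : nat).

Definition local (i : nat) : seq ltrans := if i is 0 then A else relay i.

Definition node_index (j : N) := index j [seq v i | i <- iota 0 k.+1].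

(** Nodes off the cycle have an index above [k] and stay idle. *)
Definition ring_trans (j : N) : seq (nat * bool * nat * nat) :=
  if node_index j <= k then [seq globalize (node_index j) t | t <- local (node_index j)]
  else [::].

Definition ring : protocol N E :=
  ([ffun xi => [:: msg xi false; msg xi true]],
   [ffun j => if j == v 0 then n0 else 3],
   [ffun j => if j == v 0 then i0 else 0],
   [ffun j => ring_trans j]).

Lemma node_index_v i : i <= k -> node_index (v i) = i.
Proof.
move=> li; rewrite /node_index; set s := map _ _.
have ss : size s = k.+1 by rewrite size_map size_iota.
have sn j : j <= k -> nth (v 0) s j = v j.
  by move=> lj; rewrite (nth_map 0) ?size_iota // nth_iota.
have ins : v i \in s by rewrite -(sn i) // mem_nth ?ss.
have ltx : index (v i) s <= k by rewrite -ltnS -ss index_mem.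
by apply: v_inj => //; rewrite -sn // nth_index.
Qed.

Lemma v_node_index j : node_index j <= k -> v (node_index j) = j.
Proof.
rewrite /node_index; set s := map _ _ => lt.
have ss : size s = k.+1 by rewrite size_map size_iota.
rewrite -[RHS](@nth_index _ (v 0) j s); last by rewrite -index_mem ss.
by rewrite (nth_map 0) ?size_iota // nth_iota.
Qed.

Lemma ring_transP j p sn b q : (p, sn, b, q) \in ring_trans j ->
  exists i w c, [/\ i <= k, j = v i, (p, w, c, q) \in local i,
                    sn = sends i w & b = msg (side i w) c].
Proof.
rewrite /ring_trans; case: leqP => // li /mapP[[[[p' w] c] q'] lt [-> -> -> ->]].
by exists (node_index j), w, c; rewrite v_node_index.
Qed.

Lemma mem_msgs xi b : (b \in msgs ring xi) = (b == msg xi false) || (b == msg xi true).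
Proof. by rewrite /msgs /= ffunE !inE. Qed.

Lemma msg_in_msgs xi zeta c : msg xi c \in msgs ring zeta -> xi = zeta.
Proof. by rewrite mem_msgs => /orP[] /eqP /msg_inj[]. Qed.

Lemma wf_ring : i0 < n0 ->
  (forall p w b q, (p, w, b, q) \in A -> p < n0 /\ q < n0) ->
  wf_protocol tl hd ring.
Proof.
move=> lti ltA; split; last split.
- move=> xi zeta nz b; rewrite mem_msgs => /orP[] /eqP->.
    by apply: contra nz => /msg_in_msgs ->.
  by apply: contra nz => /msg_in_msgs ->.
- by move=> j; rewrite /init /nstates /= !ffunE; case: ifP.
- move=> j p sn b q; rewrite /trans /= ffunE.
  move=> /ring_transP[i [w [c [li -> lt -> ->]]]].
  have [ltp ltq] : p < nstates ring (v i) /\ q < nstates ring (v i).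
    rewrite /nstates /= ffunE eqv //; case: i li lt => [|i] li; first exact: ltA.
    by rewrite /local /= !inE => /or4P[] /eqP[-> _ _ ->].
  split=> //; exists (side i w); split; last exact: sends_endpoint.
  by rewrite mem_msgs; case: c {lt}; rewrite eqxx ?orbT.
Qed.

(** * Queue runs as protocol runs *)

Definition set_state (St : composite_state N) (j : N) (q : nat) : composite_state N :=
  [ffun x => if x == j then q else St x].

Lemma ring_step (St : composite_state N) (C C' : channels E) i p w b q :
  i <= k -> (p, w, b, q) \in local i -> St (v i) = p ->
  (forall zeta, zeta != side i w -> C' zeta = C zeta) ->
  (if sends i w then C' (side i w) = rcons (C (side i w)) (msg (side i w) b)
   else C (side i w) = msg (side i w) b :: C' (side i w)) ->
  step tl hd ring (St, C) (set_state St (v i) q, C').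
Proof.
move=> li lt Si C'E Cb; exists (v i), p, (sends i w), (msg (side i w) b), q, (side i w).
split=> //.
- by rewrite /trans /= ffunE /ring_trans node_index_v // li; apply/mapP; exists (p, w, b, q).
- by rewrite ffunE eqxx.
- by move=> j /negPf nj; rewrite ffunE nj.
- by rewrite mem_msgs; case: b {lt Cb}; rewrite eqxx ?orbT.
- by split=> //; have := sends_endpoint w li; case: sends Cb.
Qed.

Notation steps := (clos_refl_trans _ (step tl hd ring)).

(** Between two steps of the controller the whole queue rests on [e 0]. *)
Definition queue (w : seq bool) : channels E :=
  [ffun xi => if xi == e 0 then [seq msg xi b | b <- w] else [::]].

Definition queue_with (m : nat) (b : bool) (w : seq bool) : channels E :=
  [ffun xi => if xi == e m then [:: msg xi b] else queue w xi].

(** Induction on the distance [m] from [e 0]: relay [m.+1] reads the letter by the induction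
    hypothesis and exchanges it with node [i] across [e m.+1]. *)
Lemma steps_read m : m <= k -> forall (St : composite_state N) i b p p' w,
  i <= k -> prev i = m -> (p, false, b, p') \in local i -> St (v i) = p ->
  (forall j, 0 < j <= m -> St (v j) = 0) ->
  steps (St, queue (b :: w)) (set_state St (v i) p', queue w).
Proof.
elim: m => [|m IH] lem St i b p p' w li im lt Si idle.
  have siE : side i false = e 0 by rewrite /side im.
  apply: rt_step; apply: (ring_step li lt Si); rewrite siE.
    by move=> z /negPf nz; rewrite !ffunE nz.
  by rewrite /sends im fw0 !ffunE eqxx.
have nir : i != m.+1.
  by apply/eqP => i1; rewrite i1 /= in im; move: im; lia.
have siE : side i false = e m.+1 by rewrite /side im.
have srE : side m.+1 true = e m.+1 by [].
have IHr := IH (ltnW lem) _ m.+1 b _ _ _ lem (erefl _).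
have Sr : St (v m.+1) = 0 by apply: idle; rewrite ltnSn.
have vri : (v m.+1 == v i) = false by rewrite eqv // eq_sym (negPf nir).
have idle_j j : 0 < j <= m -> [/\ j <= k, j != m.+1 & j != i].
  move=> jm; split; [lia..|]; apply/eqP => ji; subst j.
  by case: i im jm {li lt Si siE nir vri} => [|i] //= ->; lia.
(* Forward edge: the relay first fetches the letter, then sends it to node [i]. *)
case fwr: (fw m.+1).
- have r1 : (0, false, b, (nat_of_bool b).+1) \in local m.+1.
    by rewrite /local /relay fwr; case: (b); rewrite !inE.
  have r2 : ((nat_of_bool b).+1, true, b, 0) \in local m.+1.
    by rewrite /local /relay fwr; case: (b); rewrite !inE.
  apply: rt_trans (IHr St _ _ w r1 Sr _) _.
    by move=> j jm; apply: idle; lia.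
  apply: (@rt_trans _ _ _ (St, queue_with m.+1 b w)).
    have {2}-> : St = set_state (set_state St (v m.+1) b.+1) (v m.+1) 0.
      by apply/ffunP => j; rewrite !ffunE; case: eqP => // ->.
    apply: rt_step; apply: (ring_step lem r2); first by rewrite ffunE eqxx.
      by move=> z /negPf nz; rewrite ffunE -srE nz.
    by rewrite /sends fwr srE !ffunE eqxx eqe.
  apply: rt_step; apply: (ring_step li lt Si); rewrite siE.
    by move=> z /negPf nz; rewrite !ffunE nz.
  by rewrite /sends im fwr /= !ffunE eqxx eqe.
(* Backward edge: node [i] first sends the letter to the relay, which then reads the same letter
   from the preceding side. *)
- have r1 : (0, true, b, (nat_of_bool b).+1) \in local m.+1.
    by rewrite /local /relay fwr; case: (b); rewrite !inE.
  have r2 : ((nat_of_bool b).+1, false, b, 0) \in local m.+1.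
    by rewrite /local /relay fwr; case: (b); rewrite !inE.
  set St1 := set_state St (v i) p'.
  apply: (@rt_trans _ _ _ (St1, queue_with m.+1 b (b :: w))).
    apply: rt_step; apply: (ring_step li lt Si); rewrite siE.
      by move=> z /negPf nz; rewrite ffunE nz.
    by rewrite /sends im fwr /= !ffunE eqxx eqe.
  apply: (@rt_trans _ _ _ (set_state St1 (v m.+1) b.+1, queue (b :: w))).
    apply: rt_step; apply: (ring_step lem r1).
    - by rewrite ffunE vri.
    - by move=> z /negPf nz; rewrite [in RHS]ffunE -srE nz.
    by rewrite /sends fwr srE !ffunE eqxx eqe.
  have St1E : set_state (set_state St1 (v m.+1) b.+1) (v m.+1) 0 = St1.
    by apply/ffunP => j; rewrite !ffunE; case: eqP => // ->; rewrite vri Sr.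
  have := IHr (set_state St1 (v m.+1) b.+1) _ _ w r2; rewrite St1E; apply.
    by rewrite ffunE eqxx.
  move=> j jm; have [lj njr nji] := idle_j j jm.
  by rewrite !ffunE !eqv // (negPf njr) (negPf nji) idle //; lia.
Qed.

Definition controller_at (p : nat) : composite_state N :=
  [ffun x => if x == v 0 then p else 0].

Lemma set_controller p q : set_state (controller_at p) (v 0) q = controller_at q.
Proof. by apply/ffunP => j; rewrite !ffunE; case: eqP. Qed.

(** A write acts on [e 0] at once; a read takes place on [e k], at the other end of the chain of
    relays. *)
Lemma controller_steps g h : lsteps A g h ->
  steps (controller_at g.1, queue g.2) (controller_at h.1, queue h.2).
Proof.
elim=> [{}g {}h st|{}g|g1 g2 g3 _ IH1 _ IH2]; [|exact: rt_refl|exact: rt_trans IH1 IH2].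
case: st => p b p' w Ap /=; rewrite -(set_controller p p').
  apply: rt_step; apply: (@ring_step _ _ _ 0 _ true _ _ _ Ap) => //.
  - by rewrite ffunE eqxx.
  - by move=> z /negPf nz; rewrite !ffunE nz.
  - by rewrite /sends fw0 !ffunE eqxx map_rcons.
apply: (@steps_read k _ _ 0 _ _ _ _ _ _ Ap) => //; first by rewrite ffunE eqxx.
by move=> j /andP[j0 jk]; rewrite ffunE eqv // gtn_eqF.
Qed.

Lemma queue_nil : queue [::] = empty_channels E.
Proof. by apply/ffunP => xi; rewrite !ffunE; case: ifP. Qed.

Lemma stable_of_run : lsteps A (i0, [::]) (0, [::]) ->
  stable tl hd ring [ffun=> 0].
Proof.
move=> /controller_steps /=; rewrite queue_nil /stable /initial_global.
have -> : controller_at 0 = [ffun=> 0] by apply/ffunP => j; rewrite !ffunE; case: ifP.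
congr clos_refl_trans; congr pair; apply/ffunP => j.
by rewrite /init /= !ffunE.
Qed.

(** * Local histories of protocol runs *)

Lemma word_cons w l x b :
  word w ((x, b) :: l) = if x == w then b :: word w l else word w l.
Proof. by rewrite /word /=; case: ifP. Qed.

Lemma word_rcons w l x b :
  word w (rcons l (x, b)) = if x == w then rcons (word w l) b else word w l.
Proof. by rewrite /word filter_rcons /=; case: ifP => //; rewrite map_rcons. Qed.

(* [l i] is the history of node [i]; the sent part of the history of an edge
   is the received part followed by the content of the channel. *)
Definition coherent (g : composite_state N * channels E) (l : nat -> seq (bool * bool)) :=
  (forall i, i <= k -> lpath (local i) (if i == 0 then i0 else 0) (l i) (g.1 (v i))) /\
  (forall i, i <= k ->
     let out := [seq msg (e i) b | b <- word true (l i)] in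
     let inn := [seq msg (e i) b | b <- word false (l (next i))] in
     if fw i then out = inn ++ g.2 (e i) else inn = out ++ g.2 (e i)).

(** Only the acting node [i] extends its history: a write affects the condition on [e i], a read the
    one on [e (prev i)]. *)
Lemma coherent_step g h l : step tl hd ring g h -> coherent g l ->
  exists l', coherent h l'.
Proof.
case: g h => [St C] [St' C'] [j [p [sn [b [q [xi [tr [Sp Sq] St'E mb [C'E Cb]]]]]]]].
case=> /= paths chans.
rewrite /trans /= ffunE in tr.
have [i [w [c [li jE lt snE bE]]]] := ring_transP tr; subst j sn b.
have xiE := msg_in_msgs mb; subst xi.
exists (fun x => if x == i then rcons (l i) (w, c) else l x); split=> x lx /=.
  case: (eqVneq x i) => [xi|nx].
    rewrite xi Sq; apply: lpath_rcons lt; rewrite -Sp; exact: paths.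
  by rewrite St'E ?eqv //; apply: paths.
have wordE u y : word u (if y == i then rcons (l i) (w, c) else l y) =
    if (y == i) && (w == u) then rcons (word u (l y)) c else word u (l y).
  by case: eqP => // ->; rewrite word_rcons.
rewrite !wordE; have := chans x lx; case: w {wordE} lt mb tr C'E Cb => lt mb tr C'E Cb.
  rewrite /side /sends in C'E Cb; rewrite andbT andbF.
  case: (eqVneq x i) => [xi|nx]; last by rewrite C'E // eqe.
  rewrite xi; case: (fw i) Cb => -[_ Cb].
    by rewrite Cb map_rcons => ->; rewrite rcons_cat.
  by rewrite Cb map_rcons cat_rcons.
rewrite /side /sends in C'E Cb; rewrite andbT andbF.
have -> : (next x == i) = (x == prev i).
  by apply/eqP/eqP => [<-|->]; rewrite ?nextK ?prevK.
case: (eqVneq x (prev i)) => [xi|nx]; last by rewrite C'E // eqe ?prev_le.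
rewrite -xi in C'E Cb; case: (fw x) Cb => -[_ Cb].
  by rewrite Cb map_rcons cat_rcons.
by rewrite Cb map_rcons => ->; rewrite rcons_cat.
Qed.

Lemma relay_path i l : 0 < i -> lpath (local i) 0 l 0 -> word true l = word false l.
Proof.
case: i => // i _ pl.
(* The letter still held in state [p]: state 1 holds [false], state 2 holds [true]. *)
pose pend p := if p is p'.+1 then [:: p' == 1] else [::].
have: forall p m q, lpath (relay i.+1) p m q -> q = 0 ->
    word (fw i.+1) m = pend p ++ word (~~ fw i.+1) m.
  move=> p m q; elim=> {p m q} [p -> //|p w b q m z lt _ IH /IH {}IH].
  move: lt IH; rewrite /relay /= !inE !word_cons.
  by case/or4P=> /eqP[-> -> -> ->] /=; case: (fw i.+1) => /= ->.
by move/(_ _ _ _ pl (erefl _)); case: (fw i.+1).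
Qed.

(** With empty channels, coherence equates the word written by each node with the word read by the
    next. Each relay reads what it writes, so going once around closes the equality at the
    controller. *)
Lemma path_of_stable : stable tl hd ring [ffun=> 0] ->
  exists2 l, lpath A i0 l 0 & word true l = word false l.
Proof.
move=> run.
have [l [paths chans]] : exists l, coherent ([ffun=> 0], empty_channels E) l.
  have: exists l, coherent (initial_global ring) l.
    exists (fun=> [::]); split=> i li; last by rewrite /= ffunE; case: (fw i).
    by rewrite /= ffunE /init /= ffunE eqv //; apply: lpath_nil.
  elim: run => // [g h st [l]|g1 g2 g3 _ IH1 _ IH2 /IH1 /IH2 //].
  exact: coherent_step st.
have out_in i : i <= k -> word true (l i) = word false (l (next i)).
  move=> li; have := chans i li; rewrite /= ffunE !cats0.
  have inj : injective (msg (e i)) by move=> x y /msg_inj[].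
  by case: (fw i) => /(inj_map inj).
have in_out i : 0 < i <= k -> word true (l i) = word false (l i).
  case/andP=> i0' li; apply: (relay_path i0').
  by have := paths i li; rewrite gtn_eqF // ffunE.
have all0 i : i <= k -> word true (l i) = word true (l 0).
  elim: i => // i IH lti; rewrite in_out // -(IH (ltnW lti)) out_in 1?ltnW //.
  by rewrite /next ltn_eqF.
exists (l 0); first by have := paths 0 (leq0n _); rewrite ffunE.
by rewrite -(all0 k) // out_in // /next eqxx.
Qed.

End Ring.

(** * Self-application *)

(** The shape of [pickle_ffunE] with the codes of the values as input, so that these may depend on a
    computed number. *)
Definition code_fun (T : finType) (F : T -> nat) : nat :=
  CodeSeq.code [seq CodeSeq.code [:: pickle t; F t] | t <- enum T].

Lemma code_funE (T : finType) (X : countType) (F : T -> nat) (f : {ffun T -> X}) :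
  (forall t, F t = pickle (f t)) -> code_fun F = pickle f.
Proof. by move=> eF; rewrite pickle_ffunE /code_fun; under eq_map do rewrite eF. Qed.

Lemma pickle_input (N E : finType) (P : protocol N E) (St : composite_state N) :
  pickle ((P, St) : scs_input N E) =
  CodeSeq.code [:: CodeSeq.code [:: CodeSeq.code [:: CodeSeq.code [::
    pickle P.1.1.1; pickle P.1.1.2]; pickle P.1.2]; pickle P.2]; pickle St].
Proof. by case: P => [[[a b] c] d]. Qed.

Local Opaque CodeSeq.code.

Lemma computable_code_fun (T : finType) k (F : T -> seq nat -> nat) :
  (forall t, computable k (F t)) ->
  computable k (fun xs => code_fun (fun t => F t xs)).
Proof.
move=> cF; apply: computable_code => t.
by apply: computable_code2 => //; apply: computable_const.
Qed.

Lemma computable_transition k F G (sn : bool) (b : nat) :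
  computable k F -> computable k G ->
  computable k (fun xs => pickle (F xs, sn, b, G xs)).
Proof.
move=> cF cG; apply: computable_code2 => //.
apply: computable_code2; last exact: computable_const.
by apply: computable_code2 => //; apply: computable_const.
Qed.

(** Entries of a list are smaller than its code. Hence the code of the transition list of [T]
    exceeds all its states, as the loader requires. *)
Lemma transition_lt_pickle (s : seq (nat * bool * nat * nat)) p sn b q :
  (p, sn, b, q) \in s -> p < pickle s /\ q < pickle s.
Proof.
move=> ins; set t := (p, sn, b, q) in ins.
have lts : pickle t < pickle s.
  by rewrite [pickle s]pickle_seqE; apply: (allP (CodeSeq.ltn_code _)); apply: map_f.
have fst_lt (X Y : countType) (a : X) (c : Y) :
    pickle a < pickle (a, c) /\ pickle c < pickle (a, c).
  by rewrite pickle_pair; have /= /and3P[] := CodeSeq.ltn_code [:: pickle a; pickle c].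
have [l1 l2] := fst_lt _ _ (p, sn, b) q.
have [l3 _] := fst_lt _ _ (p, sn) b; have [l4 _] := fst_lt _ _ p sn.
split; last exact: ltn_trans l2 lts.
exact: ltn_trans (ltn_trans l4 (ltn_trans l3 l1)) lts.
Qed.

Section Instance.
Variables (N E : finType) (k : nat) (e : nat -> E) (v : nat -> N) (fw : nat -> bool).

Definition controller_code (T : seq instr) : seq (nat * bool * nat * nat) :=
  [seq globalize k e fw 0 t | t <- ltrans_of T].

(* The controller of [T] run on the code of its own transition list. *)
Definition self_applied (T : seq instr) : scs_input N E :=
  let x := pickle (controller_code T) in
  (ring k e v fw (controller x T) (x + x).+1 (x + x), [ffun=> 0]).

(** Primitive recursion on [n], each pass putting one loader transition in front of the list coded
    by [c]. *)
Definition code_load (x c n : nat) : nat :=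
  nat_rect (fun=> nat)
    (2 ^ pickle (globalize k e fw 0 (x, true, false, 2)) * c.*2.+1)
    (fun n r => 2 ^ pickle (globalize k e fw 0 (x + n.+1, true, true, x + n)) * r.*2.+1) n.

Lemma code_loadE x T n :
  code_load x (pickle (controller_code T)) n =
  pickle [seq globalize k e fw 0 t | t <- load x n ++ ltrans_of T].
Proof.
have code_cons a s : CodeSeq.code (a :: s) = 2 ^ a * (CodeSeq.code s).*2.+1 by [].
elim: n => [|n IH]; first by rewrite [RHS]pickle_seqE code_cons.
by rewrite [RHS]pickle_seqE code_cons -pickle_seqE -IH.
Qed.

(** Only the entries at [v 0] vary with [x]; everything else is a constant, taken from a ring with
    an empty controller. *)
Definition code_self_applied (x : nat) : nat :=
  let Q := ring k e v fw [::] 0 0 in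
  CodeSeq.code [:: CodeSeq.code [:: CodeSeq.code [:: CodeSeq.code [::
        pickle Q.1.1.1;
        code_fun (fun j : N => if j == v 0 then (x + x).+1 else 3)];
        code_fun (fun j : N => if j == v 0 then x + x else 0)];
        code_fun (fun j : N => if j == v 0 then code_load x x x
                               else pickle (ring_trans k e v fw [::] j))];
        pickle ([ffun=> 0] : composite_state N)].

Lemma code_self_appliedE T :
  code_self_applied (pickle (controller_code T)) = pickle (self_applied T).
Proof.
rewrite /self_applied; set x := pickle _.
rewrite pickle_input /code_self_applied.
rewrite (@code_funE _ _ _ (ring k e v fw (controller x T) (x + x).+1 (x + x)).1.1.2); last first.
  by move=> j; rewrite ffunE; case: ifP.
rewrite (@code_funE _ _ _ (ring k e v fw (controller x T) (x + x).+1 (x + x)).1.2); last first.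
  by move=> j; rewrite ffunE; case: ifP.
rewrite (@code_funE _ _ _ (ring k e v fw (controller x T) (x + x).+1 (x + x)).2) //.
move=> j; rewrite ffunE /ring_trans /node_index /= eq_sym.
by case: (v 0 == j) => //=; apply: code_loadE.
Qed.

Lemma computable_self_applied :
  computable 1 (fun xs => code_self_applied (nth 0 xs 0)).
Proof.
have cx n : computable n (nth 0 ^~ 0) := computable_nth n 0.
have c2x n := computable_add (cx n) (cx n).
have cif (b : bool) F G : computable 1 F -> computable 1 G ->
  computable 1 (fun xs => if b then F xs else G xs) by case: b.
apply: computable_code2; last exact: computable_const.
apply: computable_code2; last first.
  apply: computable_code_fun => j; apply: cif; last exact: computable_const.
  have cx2 : computable 3 (nth 0 ^~ 2) := computable_nth 3 2.
  have cn : computable 3 (nth 0 ^~ 0) := computable_nth 3 0.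
  have cr : computable 3 (nth 0 ^~ 1) := computable_nth 3 1.
  pose F xs := 2 ^ pickle (globalize k e fw 0 (nth 0 xs 0, true, false, 2)) *
    (nth 0 xs 0).*2.+1.
  (* Positions 0, 1 and 2 of [ys] hold the counter, the accumulator and [x]. *)
  pose G ys := 2 ^ pickle (globalize k e fw 0
      (nth 0 ys 2 + (nth 0 ys 0).+1, true, true, nth 0 ys 2 + nth 0 ys 0)) *
    (nth 0 ys 1).*2.+1.
  apply: (@computable_ext 1 (fun xs => nat_rect (fun=> nat) (F xs)
    (fun n r => G (n :: r :: xs)) (nth 0 xs 0))); first by [].
  apply: computable_prec (cx 1); apply: computable_code_cons => //.
    by apply: computable_transition => //; apply: computable_const.
  apply: computable_transition; last exact: computable_add.
  by apply: computable_add => //; apply: computable_succ.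
apply: computable_code2; last first.
  by apply: computable_code_fun => j; apply: cif => //; apply: computable_const.
apply: computable_code2; first exact: computable_const.
apply: computable_code_fun => j; apply: cif; last exact: computable_const.
exact: computable_succ.
Qed.

End Instance.

(** The final [Rot] brings the output register 1 to the front, where [machine] tests it. *)
Lemma compiled_run h x y P r :
  P = compile h [:: 0] 1 2 -> bound P <= r.+2 -> reval h [:: x] y ->
  exists cs, rexec (RSeq (rotating r.+2 P) Rot) (x :: nseq r.+1 0) (y :: cs).
Proof.
move=> PE leP ev; pose s i := if i == 0 then x else 0.
have [||||s' xs' [s'1 _]] :=
  compile_computes (s := s) (ins := [:: 0]) (out := 1) (n := 2) ev; rewrite -?PE //.
have := exec_rotating xs'; rewrite -PE => /(_ r.+2 leP) xr.
exists (others r.+2 1 s'); apply: rexec_seq.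
  have -> : x :: nseq r.+1 0 = mkseq s r.+2.
    rewrite /mkseq /=; congr [:: _, _ & _].
    apply: (@eq_from_nth _ 0) => [|i]; rewrite ?size_map ?size_iota size_nseq // => lti.
    by rewrite nth_nseq lti (nth_map 0) ?size_iota // nth_iota.
  exact: xr.
by rewrite -s'1 -rot_mkseq //; apply: rexec_rot1; rewrite size_mkseq.
Qed.

Theorem theorem7p2 (N E : finType) (tl hd : E -> N) :
  undirected_has_cycle tl hd ->
  ~ decidable_on (@scs_valid N E tl hd) (@scs_stable N E tl hd).
Proof.
move=> /has_oriented_cycle[k [e [v [fw cyc]]]] [f fP].
have [d dP] := computable_self_applied k e v fw.
pose h := RComp f [:: d]; pose P := compile h [:: 0] 1 2; pose r := bound P.
pose T := machine r.+1 (RSeq (rotating r.+2 P) Rot).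
(* [T] does not mention [x], so taking its code involves no circularity. *)
pose x := pickle (controller_code k e fw T).
have Tlt p w b q : (p, w, b, q) \in ltrans_of T -> p < x /\ q < x.
  by move=> /(map_f (globalize k e fw 0)) /transition_lt_pickle.
(* Address 2 holds an [Enq]. As 0 and 1 lie below [x], their transitions come from [T] alone. *)
have lt2x : 2 < x.
  have: (2, true, false, 3) \in ltrans_of T by rewrite mem_ltrans_of inE.
  by move/Tlt => [].
have mem_ctl p w b q : (p, w, b, q) \in controller x T -> p < x ->
    (p, w, b, q) \in ltrans_of T.
  rewrite mem_cat => /orP[/mem_load[[-> _]|[m [_ -> _]]]|//]; first by rewrite ltnn.
  by rewrite ltnNge leq_addr.
have valid : scs_valid tl hd (self_applied k e v fw T).
  split; last by move=> j; rewrite /nstates /= !ffunE; case: ifP.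
  apply: (wf_ring cyc) => // p w b q; rewrite mem_cat.
  case/orP=> [/mem_load[[-> [_ _ ->]]|[m [ltm -> [_ _ ->]]]]|/Tlt[]]; rewrite -/x; lia.
have [yes no] := fP _ valid.
have run y : reval f [:: pickle (self_applied k e v fw T)] y ->
    exists w, lsteps (controller x T) (x + x, [::])
      (if y is y'.+1 then (1, w) else (0, [::])).
  move=> ev; have evh : reval h [:: x] y.
    apply: (ev_comp (ys := [:: pickle (self_applied k e v fw T)])) ev.
    constructor; last by constructor.
    by rewrite -code_self_appliedE; apply: dP.
  have [|cs xP] := @compiled_run h x y P r (erefl _) _ evh; first by rewrite /r; lia.
  have := machine_run (@has_code_controller x T) xP => xm.
  exists (enc (y.-1 :: cs)); apply: rt_trans (load_run _ _) _.
  by case: y xm {ev evh xP}.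
(* If the state were stable, [f] would answer 1 and the genuine run would get stuck in state 1,
   contradicting the path to state 0 given by [path_of_stable]. *)
have nstable : ~ scs_stable tl hd (self_applied k e v fw T).
  move=> st; have [l pl wl] := path_of_stable cyc st.
  have [w rej] := run 1 (yes st).
  apply: (ldet_no_path _ rej _ _ _ pl) wl => //.
  - by apply: ldet_controller => p w' b q /Tlt[].
  - move=> y b q; apply/negP => /mem_ctl; rewrite mem_ltrans_of.
    by move=> H; have := H (ltnW lt2x).
  - move=> y b q /mem_ctl; rewrite mem_ltrans_of => /(_ (ltnW (ltnW lt2x))).
    by rewrite !inE => /orP[] /eqP[].
(* Hence [f] answers 0, and the accepting run makes the state stable after all. *)
have [w acc] := run 0 (no nstable).
by apply: nstable; apply: (stable_of_run cyc).
Qed.
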